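(* Let $K$ be an algebraically closed field of characteristic $0$. The Jacobian conjecture $JC_2$ for $K[X,Y]$ holds if and only if for all integers $k,n$ with $k>n\ge1$ one has $S_1(k,n)\cap\Gamma'=\emptyset$.
   Context: $S_1$ is the polynomial algebra $K[X,Y]$ with the Poisson bracket $\{f,g\}=\frac{\partial f}{\partial X}\frac{\partial g}{\partial Y}-\frac{\partial f}{\partial Y}\frac{\partial g}{\partial X}$ (the Jacobian determinant of $(f,g)$). $JC_2$ is the statement: whenever $f,g\in K[X,Y]$ have Jacobian determinant $\{f,g\}\in K\setminus\{0\}$, the $K$-algebra endomorphism of $K[X,Y]$ given by $X\mapsto f$, $Y\mapsto g$ is an automorphism. For $k,n\in\mathbb{Z}_{\ge0}$, $S_1(k,n)$ is the set of $f=\sum a_{ij}X^iY^j\in S_1$ with $a_{kn}\ne0$ and $a_{ij}=0$ whenever $i>k$ or $j>n$. $\Gamma'=\{f\in S_1\mid\exists\, g\in S_1,\ \{f,g\}=1\}$. *)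

(* Defs.v *)
From mathcomp Require Import all_boot all_algebra.
From mathcomp.multinomials Require Export mpoly.

Set Implicit Arguments.
Unset Strict Implicit.
Unset Printing Implicit Defensive.

Import GRing.Theory.
Local Open Scope ring_scope.

(* S_1 = K[X, Y] is {mpoly K[2]}, with X = 'X_iX and Y = 'X_iY. *)
Definition iX : 'I_2 := ord0.
Definition iY : 'I_2 := ord_max.

Definition pbracket (K : fieldType) (f g : {mpoly K[2]}) : {mpoly K[2]} :=
  f^`M(iX) * g^`M(iY) - f^`M(iY) * g^`M(iX).

(* As an algebra endomorphism is an automorphism exactly when it is
   bijective, no separate notion of automorphism is introduced. *)
Definition endo (K : fieldType) (f g : {mpoly K[2]}) :
    {mpoly K[2]} -> {mpoly K[2]} :=
  fun p => p \mPo [tuple f; g].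

Definition JC2 (K : fieldType) : Prop :=
  forall f g : {mpoly K[2]},
    (exists2 c : K, c != 0 & pbracket f g = c%:MP) -> bijective (endo f g).

Definition mon2 (i j : nat) : 'X_{1..2} := [multinom [tuple i; j]].

Definition S1 (K : fieldType) (k n : nat) (f : {mpoly K[2]}) : Prop :=
  f@_(mon2 k n) != 0 /\
  forall i j : nat, (k < i)%N || (n < j)%N -> f@_(mon2 i j) = 0.

Definition Gamma' (K : fieldType) (f : {mpoly K[2]}) : Prop :=
  exists g : {mpoly K[2]}, pbracket f g = 1.

(* Main.v *)
Require Import Defs.
From HB Require Import structures.
From mathcomp Require Import all_boot all_algebra.
From mathcomp Require Import ring zify.

(* Give X weight r > 0 and Y weight s >= 0; the leading form of f, dehomogenised at X = 1,
   is a polynomial P in one variable, and the leading form of a bracket {f, h} is, unless it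
   vanishes, the weighted Wronskian p P A' - a P' A of the leading forms P of f and A of h
   (of weights p and a).

   If (f, g) is an automorphism, then {f, -} is locally nilpotent on K[X, Y].  For f in
   S1 k n with k > n >= 1 the leading form is c X^k Y^n, and no iterate of its bracket
   kills X.

   Conversely let {f, g} = 1.  Then {f, -} is locally nilpotent on K[f, g], and some element
   of K[f, g] has a leading form not commuting with that of f.  Hence there are leading forms
   A, B of elements of K[f, g] with {P, A} = B <> 0 and {P, B} = 0.  Comparing orders at the
   roots of P, and degrees, shows that a root of P never has multiplicity p / (r + s), and
   that P has at most one root, or at most (r + s) deg P / p roots.  So for s > r there is at
   most one root, and for r = s = 1 at most two.  In the latter case a linear change of
   coordinates makes the leading form of f equal to c X^k Y^n with k <> n.  If n > 0, the
   bound for s > r shows that no edge of the Newton polygon leaves the vertex (k, n)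
   upwards, nor to the right by symmetry, so f or its mirror image contradicts the
   hypothesis.  If n = 0, either f lies in K[X], hence is linear, or the edge at (k, 0) is a power of
   Y - z X^t, and the substitution Y -> Y + z X^t lowers the degree of f. *)

Set Implicit Arguments.
Unset Strict Implicit.
Unset Printing Implicit Defensive.
Import GRing.Theory.
Local Open Scope ring_scope.

(** * Weighted Wronskians of univariate polynomials *)

(** Divided by [P * A] this is the logarithmic derivative of A^p / P^a. *)
Definition wronsk (R : nzRingType) (p a : nat) (P A : {poly R}) : {poly R} :=
  P * A^`() *+ p - P^`() * A *+ a.

Section Univariate.
Variable K : closedFieldType.
Hypothesis charK0 : [pchar K] =i pred0.

Lemma natr_inj0 (m n : nat) : (m%:R == n%:R :> K) = (m == n).
Proof.
have H := (pcharf0P K).1 charK0.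
wlog le_mn : m n / (m <= n)%N.
  by move=> IH; case/orP: (leq_total m n) => /IH //; rewrite eq_sym => ->; rewrite eq_sym.
by rewrite -subr_eq0 -opprB oppr_eq0 -natrB // H subn_eq0 eqn_leq le_mn.
Qed.

Lemma mulrn_eq0_char0 (x : K) (n : nat) : (x *+ n == 0) = (n == 0%N) || (x == 0).
Proof. by rewrite -mulr_natr mulf_eq0 (natr_inj0 n 0) orbC. Qed.

(** The extra factor ['X - r%:P] avoids the exponent m - 1, so that the formula also covers m =
    0. *)
Lemma deriv_XsubC_exp (r : K) (m : nat) (U : {poly K}) :
  ('X - r%:P) * (('X - r%:P) ^+ m * U)^`() =
  ('X - r%:P) ^+ m * (U *+ m + ('X - r%:P) * U^`()).
Proof.
rewrite derivM deriv_exp derivB derivX derivC subr0 mul1r.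
by case: m => [|m]; rewrite /= ?mulr0n ?exprS; ring.
Qed.

(** [Z.[r]] is the lowest coefficient of the Wronskian at r: for [U] and [V] nonvanishing at r, the
    order there is m + n - 1 unless p n = a m. *)
Lemma wronsk_local (p a m n : nat) (r : K) (U V : {poly K}) :
  exists2 Z, ('X - r%:P) * wronsk p a (('X - r%:P) ^+ m * U) (('X - r%:P) ^+ n * V)
           = ('X - r%:P) ^+ (m + n) * Z
    & Z.[r] = U.[r] * V.[r] * ((p * n)%:R - (a * m)%:R).
Proof.
have HU := deriv_XsubC_exp r m U; have HV := deriv_XsubC_exp r n V.
set L := 'X - r%:P in HU HV *.
exists (U * (V *+ n + L * V^`()) *+ p - (U *+ m + L * U^`()) * V *+ a).
  rewrite /wronsk mulrBr !mulrnAr.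
  have -> : L * (L ^+ m * U * (L ^+ n * V)^`()) = L ^+ m * U * (L * (L ^+ n * V)^`()).
    by ring.
  rewrite HV [L * (_^`() * _)]mulrA HU exprD; ring.
by rewrite /L !(hornerE, hornerMn) subrr !mul0r !natrM; ring.
Qed.

Lemma XsubC_exp_eq (r : K) (m n : nat) (U V : {poly K}) :
  ~~ root U r -> ('X - r%:P) ^+ m * V = ('X - r%:P) ^+ n * U -> (m <= n)%N.
Proof.
move=> Ur E; rewrite leqNgt; apply: contra Ur => lt_nm; rewrite /root.
have nz : ('X - r%:P) ^+ n != 0 by rewrite expf_neq0 // polyXsubC_eq0.
move: E; rewrite -(subnK (ltnW lt_nm)) addnC exprD -mulrA => /(mulfI nz) <-.
by rewrite -(subnSK lt_nm) exprS !hornerE subrr !mul0r.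
Qed.

Lemma mup_factor (r : K) (P : {poly K}) : P != 0 ->
  exists2 U, ~~ root U r & P = ('X - r%:P) ^+ mup r P * U.
Proof.
move=> nzP; have [m [U]] := multiplicity_XsubC P r; rewrite nzP /= => Ur E.
exists U => //; rewrite [LHS]E mulrC; congr (_ ^+ _ * _).
by rewrite E mupMr // mup_XsubCX eqxx.
Qed.

Lemma wronsk_eq0_mup p b (P B : {poly K}) r : P != 0 -> B != 0 ->
  wronsk p b P B = 0 -> (p * mup r B = b * mup r P)%N.
Proof.
move=> nzP nzB E.
have [U Ur EP] := mup_factor r nzP; have [V Vr EB] := mup_factor r nzB.
have [Z EZ Zr] := wronsk_local p b (mup r P) (mup r B) r U V.
move: EZ; rewrite -EP -EB E mulr0 => /esym/eqP; rewrite mulf_eq0.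
rewrite expf_eq0 polyXsubC_eq0 andbF /= => /eqP Z0.
move: Ur Vr; rewrite /root => /negPf nU /negPf nV.
move: Zr; rewrite Z0 horner0 => /esym/eqP; rewrite !mulf_eq0 nU nV /=.
by rewrite subr_eq0 natr_inj0 => /eqP.
Qed.

(** By [wronsk_local] the order of the Wronskian at r is one less than the sum of the orders, except
    in the proportional case, where the lowest term cancels and at least one order is gained. *)
Lemma wronsk_mup p a (P A B : {poly K}) c r : P != 0 -> A != 0 -> B != 0 -> c != 0 ->
  wronsk p a P A = c *: B ->
  ((p * mup r A != a * mup r P) && (mup r P + mup r A == (mup r B).+1))%N
  || ((p * mup r A == a * mup r P) && (mup r P + mup r A <= mup r B))%N.
Proof.
move=> nzP nzA nzB nzc E.
have [U Ur EP] := mup_factor r nzP; have [V Vr EA] := mup_factor r nzA.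
have [T Tr EB] := mup_factor r nzB.
have [Z EZ Zr] := wronsk_local p a (mup r P) (mup r A) r U V.
have nzL : 'X - r%:P != 0 by rewrite polyXsubC_eq0.
have cT : ~~ root (c *: T) r by rewrite rootZ.
have E1 : ('X - r%:P) ^+ (mup r P + mup r A) * Z = ('X - r%:P) ^+ (mup r B).+1 * (c *: T).
  by rewrite -EZ -EP -EA E [in LHS]EB exprS scalerAr mulrA.
have le1 := XsubC_exp_eq cT E1.
have [eq_pa|ne_pa] := eqVneq (p * mup r A)%N (a * mup r P)%N => /=.
  have : root Z r by rewrite /root Zr eq_pa subrr mulr0.
  case/factor_theorem => Z1 EZ1.
  have : ('X - r%:P) ^+ (mup r P + mup r A).+1 * Z1 = ('X - r%:P) ^+ (mup r B).+1 * (c *: T).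
    by rewrite -E1 EZ1 exprS; ring.
  by move/(XsubC_exp_eq cT).
have nZr : ~~ root Z r.
  move: Ur Vr; rewrite /root => /negPf nU /negPf nV.
  by rewrite Zr !mulf_eq0 nU nV /= subr_eq0 natr_inj0.
by rewrite orbF eqn_leq le1 (XsubC_exp_eq nZr (esym E1)).
Qed.

Lemma coefM_top (R : nzRingType) (P Q : {poly R}) (m n : nat) :
  (size P <= m.+1)%N -> (size Q <= n.+1)%N -> (P * Q)`_(m + n) = P`_m * Q`_n.
Proof.
move=> sP sQ; rewrite coefM.
have lt_m : (m < (m + n).+1)%N by rewrite ltnS leq_addr.
rewrite (bigD1 (Ordinal lt_m)) //= addKn big1 ?addr0 // => i ne_i.
have {ne_i} : (i : nat) != m by apply: contra ne_i => /eqP E; apply/eqP/val_inj.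
rewrite neq_ltn => /orP[lt_i|lt_i].
  by rewrite [Q`__]nth_default ?mulr0 // (leq_trans sQ) //; lia.
by rewrite nth_default ?mul0r // (leq_trans sP).
Qed.

(** The analogue of [wronsk_local] at infinity: X d/dX multiplies the coefficient of X^i by i and
    does not raise the degree. *)
Lemma coef_wronsk_top p a (P A : {poly K}) (d n : nat) :
  (size P <= d.+1)%N -> (size A <= n.+1)%N ->
  ('X * wronsk p a P A)`_(d + n) = P`_d * A`_n * ((p * n)%:R - (a * d)%:R).
Proof.
have XD (Q : {poly K}) i : ('X * Q^`())`_i = Q`_i *+ i.
  by rewrite coefXM coef_deriv; case: i.
have sXD (Q : {poly K}) i : (size Q <= i.+1)%N -> (size ('X * Q^`())%R <= i.+1)%N.
  by move=> sQ; apply/leq_sizeP => j lt_ij; rewrite XD nth_default ?mul0rn // (leq_trans sQ).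
move=> sP sA; rewrite /wronsk mulrBr !mulrnAr coefB !coefMn.
rewrite [_ * (P * _)]mulrCA [_ * (_ * A)]mulrA !coefM_top ?sXD // !XD !natrM; ring.
Qed.

Lemma coef_lead_size (P : {poly K}) (d : nat) : size P = d.+1 -> P`_d != 0.
Proof. by move=> sP; rewrite -[d]/(d.+1.-1) -sP -lead_coefE lead_coef_eq0 -size_poly_gt0 sP. Qed.

Lemma wronsk_eq0_deg p b (P B : {poly K}) d l : size P = d.+1 -> size B = l.+1 ->
  wronsk p b P B = 0 -> (p * l = b * d)%N.
Proof.
move=> sP sB E; have := @coef_wronsk_top p b P B d l.
rewrite sP sB E mulr0 coef0 => /(_ (leqnn _) (leqnn _))/esym/eqP.
rewrite !mulf_eq0 (negPf (coef_lead_size sP)) (negPf (coef_lead_size sB)) /=.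
by rewrite subr_eq0 natr_inj0 => /eqP.
Qed.

Lemma wronsk_deg p a (P A B : {poly K}) c d n l : c != 0 ->
  size P = d.+1 -> size A = n.+1 -> size B = l.+1 ->
  wronsk p a P A = c *: B -> (p * n = a * d)%N \/ (d + n = l.+1)%N.
Proof.
move=> nzc sP sA sB E.
have [|ne_pa] := eqVneq (p * n)%N (a * d)%N; [by left | right].
have ts m : (d + n <= m)%N -> (size ('X * wronsk p a P A)%R <= m.+1)%N.
  move=> le_m; apply/leq_sizeP => j lt_mj; rewrite -(subnK (leq_trans le_m (ltnW lt_mj))) addnC.
  rewrite -addnA coef_wronsk_top ?sP ?sA //; last by lia.
  by rewrite [A`_ _]nth_default ?mulr0 ?mul0r ?sA //; lia.
have sB' : size ('X * wronsk p a P A) = l.+2.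
  by rewrite E -scalerAr size_scale // mulrC size_mulX ?sB // -size_poly_gt0 sB.
have := ts _ (leqnn _); rewrite sB' ltnS => le1.
apply/eqP; rewrite eqn_leq le1 andbT.
rewrite leqNgt; apply/negP => lt1.
have := coef_wronsk_top p a (eq_leq sP) (eq_leq sA).
rewrite nth_default ?sB' // => /esym/eqP.
rewrite !mulf_eq0 (negPf (coef_lead_size sP)) (negPf (coef_lead_size sA)) /=.
by rewrite subr_eq0 natr_inj0 (negPf ne_pa).
Qed.

(** Over an algebraically closed field the degree counts roots with multiplicity, and the roots of V
    together with s form a sub-multiset of those of U. *)
Lemma mup_size_leq (U V : {poly K}) (s : seq K) : U != 0 -> V != 0 -> uniq s ->
  (forall r, mup r V + (r \in s) <= mup r U)%N -> (size V + size s <= size U)%N.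
Proof.
move=> nzU nzV us H.
have [u Eu] := closed_field_poly_normal U; have [v Ev] := closed_field_poly_normal V.
have mu (W : {poly K}) w r : W != 0 -> W = lead_coef W *: \prod_(z <- w) ('X - z%:P) ->
    mup r W = count_mem r w.
  by move=> nzW ->; rewrite -mul_polyC mupMr ?mu_prod_XsubC // rootC lead_coef_eq0.
have sz (W : {poly K}) w : W != 0 -> W = lead_coef W *: \prod_(z <- w) ('X - z%:P) ->
    size W = (size w).+1.
  by move=> nzW ->; rewrite size_scale ?lead_coef_eq0 // size_prod_XsubC.
rewrite (sz _ _ nzU Eu) (sz _ _ nzV Ev) addSn ltnS -size_cat.
have /count_subseqP[w sub_w /perm_size ->] : forall r, (count_mem r (v ++ s) <= count_mem r u)%N.
  by move=> r; have := H r; rewrite (mu _ _ _ nzU Eu) (mu _ _ _ nzV Ev) count_cat (count_uniq_mem _ us).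
exact: size_subseq.
Qed.

(** * Roots of a leading form [P] with {P, A} = B and {P, B} = 0 *)

Section Roots.
Variables (p e a b d : nat) (P A B : {poly K}) (c : K).
(** [e] stands for the sum r + s of the weights of X and Y, by which a bracket lowers the total
    weight; this is [eq_ab]. *)
Hypotheses (p_gt0 : (0 < p)%N) (e_gt0 : (0 < e)%N) (eq_ab : (a + p = b + e)%N).
Hypotheses (sP : size P = d.+1) (nzB : B != 0) (nzc : c != 0).
Hypotheses (EA : wronsk p a P A = c *: B) (EB : wronsk p b P B = 0).

Let nzP : P != 0. Proof. by rewrite -size_poly_gt0 sP. Qed.
Let nzA : A != 0.
Proof.
apply: contraNneq nzB => A0; move: EA.
by rewrite A0 /wronsk derivC !mulr0 !mul0rn subrr => /esym/eqP; rewrite scaler_eq0 (negPf nzc).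
Qed.

(** The proportional case of [wronsk_mup] is impossible at a root of multiplicity m > 0: multiplying
    its inequality by p gives (p + a) m <= b m, while a + p = b + e > b. *)
Lemma mup_root r : root P r ->
  (p * mup r A != a * mup r P)%N /\ (mup r P + mup r A = (mup r B).+1)%N.
Proof.
move=> rP.
have m_gt0 : (0 < mup r P)%N by rewrite -XsubC_dvd // dvdp_XsubCl.
case/orP: (wronsk_mup r nzP nzA nzB nzc EA) => /andP[]; first by move=> ? /eqP.
have := wronsk_eq0_mup r nzP nzB EB; nia.
Qed.

(** With m = [mup r P], multiplying the identity of [mup_root] by p and inserting p [mup r B] = b m
    gives p [mup r A] - a m = p - e m, and the left side is nonzero. *)
Lemma mup_neq r : root P r -> (e * mup r P != p)%N.
Proof.
move=> rP; have [ne1 eq1] := mup_root rP; have := wronsk_eq0_mup r nzP nzB EB.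
by apply: contra_eqN => /eqP; nia.
Qed.

(** At each root of P the product A P has one order more than B, and B vanishes only at roots of P;
    hence deg B + |s| <= deg A + deg P. The two cases of [wronsk_deg] turn this into the two
    bounds. *)
Lemma size_roots (s : seq K) : uniq s -> all (root P) s ->
  (size s <= 1)%N \/ (size s * p <= e * d)%N.
Proof.
move=> us /allP rs.
have : (size B + size s <= size (A * P)%R)%N.
  apply: mup_size_leq => //; first by rewrite mulf_neq0.
  move=> r; rewrite mupM //; case: (boolP (r \in s)) => [/rs/mup_root[_]|_]; first by lia.
  case: (boolP (root P r)) => [/mup_root[_]|nr]; first by lia.
  have := wronsk_eq0_mup r nzP nzB EB; rewrite (mupNroot nr) muln0 => /eqP.
  by rewrite muln_eq0 eqn0Ngt p_gt0 => /eqP ->.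
rewrite size_mul // sP.
have [n sA] : exists n, size A = n.+1.
  by exists (size A).-1; rewrite prednK // size_poly_gt0.
have [l sB] : exists l, size B = l.+1.
  by exists (size B).-1; rewrite prednK // size_poly_gt0.
rewrite sA sB; have := wronsk_eq0_deg sP sB EB.
case: (wronsk_deg nzc sP sA sB EA) => [E1 E2|E1 E2]; last by left; lia.
by move=> H; right; nia.
Qed.

End Roots.
End Univariate.

(** * Weighted leading forms *)

Lemma forall_I2 (Q : 'I_2 -> Prop) : Q iX -> Q iY -> forall i, Q i.
Proof.
move=> QX QY [[|[|//]] lt_i].
  by have -> : Ordinal lt_i = iX by apply: val_inj.
by have -> : Ordinal lt_i = iY by apply: val_inj.
Qed.

Lemma big_I2 (R : Type) (idx : R) (op : Monoid.law idx) (F : 'I_2 -> R) :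
  \big[op/idx]_(i < 2) F i = op (F iX) (F iY).
Proof. by rewrite !big_ord_recl big_ord0 Monoid.mulm1; congr (op _ (F _)); apply: val_inj. Qed.

Lemma mon2X i j : mon2 i j iX = i. Proof. by []. Qed.
Lemma mon2Y i j : mon2 i j iY = j. Proof. by []. Qed.

Lemma mon2E (m : 'X_{1..2}) : m = mon2 (m iX) (m iY).
Proof. by apply/mnmP; apply: forall_I2. Qed.

Lemma mon2_eq i j i' j' : (mon2 i j == mon2 i' j') = (i == i') && (j == j').
Proof.
apply/eqP/andP => [E|[/eqP-> /eqP->]] //.
by split; apply/eqP; [rewrite -[i](mon2X i j) E | rewrite -[j](mon2Y i j) E].
Qed.

Lemma mon2_00 : mon2 0 0 = 0%MM.
Proof. by apply/mnmP; apply: forall_I2; rewrite mnm0E. Qed.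

Lemma mon2_addX i j : (mon2 i j + U_(iX))%MM = mon2 i.+1 j.
Proof. by apply/mnmP; apply: forall_I2; rewrite mnmDE mnm1E /= ?addn1 ?addn0. Qed.

Lemma mon2_addY i j : (mon2 i j + U_(iY))%MM = mon2 i j.+1.
Proof. by apply/mnmP; apply: forall_I2; rewrite mnmDE mnm1E /= ?addn1 ?addn0. Qed.

(** * Substitutions, partial derivatives and the bracket in two variables *)

Section TwoVariables.
Variable K : fieldType.
Implicit Types f g h p q u v : {mpoly K[2]}.

Notation x := ('X_iX : {mpoly K[2]}).
Notation y := ('X_iY : {mpoly K[2]}).

Lemma mpoly2P f g : (forall i j, f@_(mon2 i j) = g@_(mon2 i j)) -> f = g.
Proof. by move=> E; apply/mpolyP => m; rewrite (mon2E m). Qed.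

Lemma mcoeffC2 (c : K) i j :
  (c%:MP : {mpoly K[2]})@_(mon2 i j) = if (i == 0%N) && (j == 0%N) then c else 0.
Proof. by rewrite mcoeffC -mon2_00 mon2_eq; case: ifP => _; rewrite ?mulr1 ?mulr0. Qed.

Lemma mpoly2_ind (Q : {mpoly K[2]} -> Prop) :
  (forall c, Q c%:MP) -> Q x -> Q y -> (forall f g, Q f -> Q g -> Q (f + g)) ->
  (forall f g, Q f -> Q g -> Q (f * g)) -> forall f, Q f.
Proof.
move=> QC Qx Qy QD QM; have Qn f n : Q f -> Q (f ^+ n).
  by move=> Qf; elim: n => [|n IH]; rewrite ?exprS; [exact: QC 1 | apply: QM].
elim/mpolyind => [|c m f _ _ Qf]; first exact: QC 0.
apply: QD => //; rewrite -mul_mpolyC mpolyXE_id big_I2.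
by apply: (QM); [exact: QC | apply: (QM); apply: Qn].
Qed.

Lemma endoE u v f : endo u v f = \sum_(m <- msupp f) f@_m *: (u ^+ m iX * v ^+ m iY).
Proof. by rewrite /endo comp_mpolyE; apply: eq_bigr => m _; rewrite big_I2. Qed.

HB.instance Definition _ u v :=
  GRing.RMorphism.copy (endo u v) (comp_mpoly [tuple u; v]).

Lemma endoC u v c : endo u v c%:MP = c%:MP. Proof. exact: comp_mpolyC. Qed.
Lemma endoZ u v c f : endo u v (c *: f) = c *: endo u v f. Proof. exact: comp_mpolyZ. Qed.
Lemma endo_x u v : endo u v x = u. Proof. exact: comp_mpolyXU. Qed.
Lemma endo_y u v : endo u v y = v. Proof. exact: comp_mpolyXU. Qed.

Lemma endo_id f : endo x y f = f.
Proof.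
elim/mpoly2_ind: f => [c|||f g Ef Eg|f g Ef Eg]; rewrite ?endoC ?endo_x ?endo_y //.
  by rewrite rmorphD /= Ef Eg.
by rewrite rmorphM /= Ef Eg.
Qed.

Lemma endo_comp u v p q f : endo u v (endo p q f) = endo (endo u v p) (endo u v q) f.
Proof.
elim/mpoly2_ind: f => [c|||f g Ef Eg|f g Ef Eg].
- by rewrite !endoC.
- by rewrite !endo_x.
- by rewrite !endo_y.
- by rewrite !rmorphD /= Ef Eg.
- by rewrite !rmorphM /= Ef Eg.
Qed.

Lemma mderivU (i j : 'I_2) : ('X_i : {mpoly K[2]})^`M(j) = (i == j)%:R.
Proof.
rewrite mderivX mnm1E; case: eqP => [->|]; last by rewrite scale0r.
rewrite scale1r -[RHS]mpolyX0; congr ('X_[_]).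
by apply/mnmP => k; rewrite mnmBE subnn mnm0E.
Qed.

Lemma mderiv_endo u v f i :
  (endo u v f)^`M(i) = endo u v f^`M(iX) * u^`M(i) + endo u v f^`M(iY) * v^`M(i).
Proof.
elim/mpoly2_ind: f => [c|||f g Ef Eg|f g Ef Eg].
- by rewrite endoC !mderivC rmorph0 !mul0r addr0.
- by rewrite endo_x !mderivU /= rmorph1 rmorph0 mul1r mul0r addr0.
- by rewrite endo_y !mderivU /= rmorph1 rmorph0 mul1r mul0r add0r.
- by rewrite !(rmorphD, mderivD) /= Ef Eg; ring.
- by rewrite !(rmorphM, rmorphD, mderivM) /= Ef Eg; ring.
Qed.

Lemma pbracket_endo u v f g :
  pbracket (endo u v f) (endo u v g) = endo u v (pbracket f g) * pbracket u v.
Proof. by rewrite /pbracket !mderiv_endo rmorphB !rmorphM /=; ring. Qed.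

(** In the coordinates (f, g) the operator {f, -} is {f, g} times the derivative in g. *)
Lemma pbracket_endol f g q : pbracket f (endo f g q) = endo f g q^`M(iY) * pbracket f g.
Proof. by rewrite /pbracket !mderiv_endo; ring. Qed.

Lemma pbracket_endor f g q : pbracket (endo f g q) g = endo f g q^`M(iX) * pbracket f g.
Proof. by rewrite /pbracket !mderiv_endo; ring. Qed.

Lemma pbracketC f g : pbracket g f = - pbracket f g.
Proof. by rewrite /pbracket; ring. Qed.

Lemma pbracketZr f g c : pbracket f (c *: g) = c *: pbracket f g.
Proof. by rewrite /pbracket !mderivZ -!scalerAr scalerBr. Qed.

Lemma pbracket0 f : pbracket f 0 = 0.
Proof. by rewrite /pbracket !mderiv0 !mulr0 subrr. Qed.

Lemma coef_mderivX f i j : (f^`M(iX))@_(mon2 i j) = f@_(mon2 i.+1 j) *+ i.+1.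
Proof. by rewrite mcoeff_deriv mon2_addX mon2X. Qed.

Lemma coef_mderivY f i j : (f^`M(iY))@_(mon2 i j) = f@_(mon2 i j.+1) *+ j.+1.
Proof. by rewrite mcoeff_deriv mon2_addY mon2Y. Qed.

Lemma coef_swap f i j : (endo y x f)@_(mon2 i j) = f@_(mon2 j i).
Proof.
elim/mpolyind: f => [|c m f _ _ IH]; first by rewrite rmorph0 !mcoeff0.
rewrite rmorphD /= endoZ !mcoeffD !mcoeffZ IH; congr (_ * _ + _).
rewrite /endo comp_mpolyX big_I2 /= (tnth_nth 0) (tnth_nth 0) /= !mpolyXn -mpolyXD !mcoeffX.
congr (_%:R : K); congr (nat_of_bool _); rewrite (mon2E m).
have -> : (U_(iY) *+ mon2 (m iX) (m iY) iX + U_(iX) *+ mon2 (m iX) (m iY) iY)%MM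
          = mon2 (m iY) (m iX).
  by apply/mnmP; apply: forall_I2; rewrite mnmDE !mulmnE !mnm1E /= ?mul0n ?mul1n ?addn0.
by rewrite !mon2_eq andbC.
Qed.

(* With X of weight r and Y of weight s, the coefficient of t ^ d in [wpoly r s f]
   is the component of weight d of f, dehomogenised at X = 1; for 0 < r nothing is lost. *)
Definition wpoly_img (r s : nat) (i : 'I_2) : {poly {poly K}} :=
  if i == iX then 'X^r else 'X%:P * 'X^s.

Definition wpoly (r s : nat) (f : {mpoly K[2]}) : {poly {poly K}} :=
  mmap (polyC \o polyC : {rmorphism K -> {poly {poly K}}}) (wpoly_img r s) f.

HB.instance Definition _ r s := GRing.RMorphism.copy (wpoly r s)
  (mmap (polyC \o polyC : {rmorphism K -> {poly {poly K}}}) (wpoly_img r s)).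

Lemma wpolyC r s c : wpoly r s c%:MP = c%:P%:P.
Proof. exact: mmapC. Qed.

Lemma wpoly_x r s : wpoly r s x = 'X^r.
Proof. by rewrite /wpoly mmapX mmap1U. Qed.

Lemma wpoly_y r s : wpoly r s y = 'X%:P * 'X^s.
Proof. by rewrite /wpoly mmapX mmap1U. Qed.

Lemma wpolyZ r s c f : wpoly r s (c *: f) = c%:P *: wpoly r s f.
Proof. by rewrite -mul_mpolyC rmorphM /= wpolyC mul_polyC. Qed.

(** The monomial X^i Y^j is sent to Y^j t^(r i + s j), so d and j determine i as (d - s j) / r. *)
Lemma coef_wpoly r s f d j : (0 < r)%N ->
  (wpoly r s f)`_d`_j =
    if (s * j <= d)%N && (r %| d - s * j)%N then f@_(mon2 ((d - s * j) %/ r) j) else 0.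
Proof.
move=> r_gt0; elim/mpolyind: f => [|c m f _ _ IH]; first by rewrite rmorph0 !coef0 mcoeff0 if_same.
rewrite rmorphD /= wpolyZ !coefD IH coefZ coefCM mcoeffD mcoeffZ mcoeffX.
rewrite {2}(mon2E m) mon2_eq.
have -> : wpoly r s 'X_[m] = ('X^(m iY))%:P * 'X^(r * m iX + s * m iY).
  rewrite /wpoly mmapX /mmap1 big_I2 /= exprMn -!exprM rmorphXn /= exprD; ring.
rewrite coefCM coefXn.
case: eqVneq => [->|ne_d]; rewrite ?mulr1 ?mulr0 ?coef0 ?coefXn.
  have [->|ne_j] := eqVneq j (m iY).
    by rewrite leq_addl addnK dvdn_mulr // mulKn // !eqxx.
  by case: ifP => _; rewrite 1?eq_sym ?(negPf ne_j) ?andbF ?mulr0 ?add0r.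
case: ifP => [/andP[le_d /dvdnP[k Ek]]|]; rewrite ?mulr0 ?add0r //.
case: eqP => [E1|]; case: eqP => [E2|] /=; rewrite ?mulr0 ?add0r //.
by case/eqP: ne_d; rewrite E1 E2 mulnC divnK ?subnK // Ek dvdn_mull.
Qed.

Lemma coef_wpoly_mon2 r s f i j : (0 < r)%N -> (wpoly r s f)`_(r * i + s * j)`_j = f@_(mon2 i j).
Proof. by move=> r_gt0; rewrite coef_wpoly // leq_addl addnK dvdn_mulr // mulKn. Qed.

Lemma coef_wpoly0 r s f d j : (0 < r)%N ->
  (forall i, d = (r * i + s * j)%N -> f@_(mon2 i j) = 0) -> (wpoly r s f)`_d`_j = 0.
Proof.
move=> r_gt0 H; rewrite coef_wpoly //; case: ifP => // /andP[le_d /divnK E].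
by apply: H; rewrite mulnC E subnK.
Qed.

Lemma coef_wpoly11 f i j : (wpoly 1 1 f)`_(i + j)`_j = f@_(mon2 i j).
Proof. by rewrite -(@coef_wpoly_mon2 1 1) // !mul1n. Qed.

Lemma wpoly_inj r s : (0 < r)%N -> injective (wpoly r s).
Proof.
by move=> r_gt0 f g E; apply: mpoly2P => i j; rewrite -!(coef_wpoly_mon2 s _ _ _ r_gt0) E.
Qed.

Lemma wpoly_eq0 r s f : (0 < r)%N -> (wpoly r s f == 0) = (f == 0).
Proof. by move=> r_gt0; rewrite -(inj_eq (@wpoly_inj r s r_gt0)) rmorph0. Qed.

(** The derivative in the inner variable, the dehomogenised Y; [deriv] on the outer level
    differentiates in the weight variable t. *)
Definition dy (F : {poly {poly K}}) : {poly {poly K}} := map_poly (@deriv K) F.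

Lemma coef_dy F i : (dy F)`_i = (F`_i)^`().
Proof. by rewrite coef_map_id0 // deriv0. Qed.

Lemma dyD F G : dy (F + G) = dy F + dy G.
Proof. by apply/polyP => i; rewrite !(coefD, coef_dy) derivD. Qed.

Lemma dyM F G : dy (F * G) = dy F * G + F * dy G.
Proof.
apply/polyP => i; rewrite coefD coef_dy !coefM raddf_sum -big_split /=.
by apply: eq_bigr => j _; rewrite !coef_dy -derivM.
Qed.

Lemma dyC (P : {poly K}) : dy P%:P = (P^`())%:P.
Proof. by apply/polyP => i; rewrite coef_dy !coefC; case: eqP => // _; rewrite deriv0. Qed.

Lemma dyXn n : dy 'X^n = 0.
Proof. by apply/polyP => i; rewrite coef_dy coefXn coef0; case: eqP => _; rewrite ?deriv0 ?derivC. Qed.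

Lemma dy_wpoly r s f : dy (wpoly r s f) = 'X^s * wpoly r s f^`M(iY).
Proof.
elim/mpoly2_ind: f => [c|||f g Ef Eg|f g Ef Eg].
- by rewrite wpolyC dyC derivC mderivC !rmorph0 mulr0.
- by rewrite wpoly_x dyXn mderivU /= rmorph0 mulr0.
- by rewrite wpoly_y dyM dyC dyXn derivX mderivU /= !rmorph1 mul1r mulr0 addr0 mulr1.
- by rewrite mderivD !rmorphD /= dyD Ef Eg; ring.
- by rewrite mderivM rmorphD !rmorphM /= dyM Ef Eg; ring.
Qed.

(** The chain rule for f(t^r, Y t^s); the factor t avoids the exponents r - 1 and s - 1. *)
Lemma deriv_wpoly r s f :
  'X * (wpoly r s f)^`() = 'X^r * wpoly r s f^`M(iX) *+ r + 'X%:P * 'X^s * wpoly r s f^`M(iY) *+ s.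
Proof.
have DX n : 'X * ('X^n : {poly {poly K}})^`() = 'X^n *+ n.
  by rewrite derivXn mulrnAr; case: n => [|n]; rewrite ?mulr0n -?exprS.
elim/mpoly2_ind: f => [c|||f g Ef Eg|f g Ef Eg].
- by rewrite wpolyC derivC !mderivC rmorph0 !mulr0 !mul0rn addr0.
- by rewrite wpoly_x DX !mderivU /= rmorph1 rmorph0 mulr0 mulr1 mul0rn addr0.
- rewrite wpoly_y derivM derivC mul0r add0r mulrCA DX !mderivU /= rmorph1 rmorph0.
  by rewrite mulr0 mulr1 mul0rn add0r mulrnAr.
- by rewrite !(mderivD, rmorphD) /= derivD mulrDr Ef Eg; ring.
- rewrite !(mderivM, rmorphD, rmorphM) /= derivM mulrDr mulrA Ef.
  by rewrite [_ * (_ * _^`())]mulrCA Eg; ring.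
Qed.

Definition jac (F G : {poly {poly K}}) := F^`() * dy G - dy F * G^`().

(** The map (t, Y) -> (t^r, Y t^s) has Jacobian determinant r t^(r + s - 1). *)
Lemma jac_wpoly r s f g :
  'X * jac (wpoly r s f) (wpoly r s g) = 'X^(r + s) * wpoly r s (pbracket f g) *+ r.
Proof.
rewrite /jac mulrBr mulrA deriv_wpoly [_ * (dy _ * _)]mulrCA deriv_wpoly !dy_wpoly.
by rewrite /pbracket rmorphB !rmorphM /= exprD; ring.
Qed.

Lemma size_coef_X_deriv (F : {poly {poly K}}) (m : nat) :
  (size F <= m)%N -> (size ('X * F^`())%R <= m)%N.
Proof.
move=> sF; apply/leq_sizeP => j le_mj; rewrite coefXM coef_deriv; case: j le_mj => // j le_mj.
by rewrite nth_default ?mul0rn // (leq_trans sF).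
Qed.

(** t d/dt multiplies the coefficient of t^p by p, which is how the degrees in t become the weights
    of the Wronskian. *)
Lemma coef_jac_top (F G : {poly {poly K}}) (p a : nat) :
  (size F <= p.+1)%N -> (size G <= a.+1)%N ->
  ('X * jac F G)`_(p + a) = wronsk p a F`_p G`_a.
Proof.
move=> sF sG.
have sdy (H : {poly {poly K}}) m : (size H <= m)%N -> (size (dy H) <= m)%N.
  by move=> sH; rewrite (leq_trans (size_poly _ _)).
have XD (H : {poly {poly K}}) i : ('X * H^`())`_i = H`_i *+ i.
  by rewrite coefXM coef_deriv; case: i.
rewrite /jac mulrBr mulrA [_ * (dy _ * _)]mulrCA coefB.
rewrite !coefM_top ?sdy ?size_coef_X_deriv // !XD !coef_dy /wronsk.
by rewrite mulrnAl mulrnAr.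
Qed.

End TwoVariables.

(** * Leading forms of a Jacobian pair *)

Section JacobianPairs.
Variable K : closedFieldType.
Hypothesis charK0 : [pchar K] =i pred0.
Implicit Types f g h q : {mpoly K[2]}.

Definition wdeg (r s : nat) f : nat := (size (wpoly r s f)).-1.
Definition wlead (r s : nat) f : {poly K} := lead_coef (wpoly r s f).

Lemma natr_neq0 (n : nat) : (0 < n)%N -> n%:R != 0 :> K.
Proof. by move=> n_gt0; rewrite (natr_inj0 charK0 n 0) -lt0n. Qed.

Lemma polyMn_eq0 (P : {poly K}) (n : nat) : (0 < n)%N -> (P *+ n == 0) = (P == 0).
Proof. by move=> n_gt0; rewrite -scaler_nat scaler_eq0 (negPf (natr_neq0 n_gt0)). Qed.

Lemma size_wpoly r s f : (0 < r)%N -> f != 0 -> size (wpoly r s f) = (wdeg r s f).+1.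
Proof. by move=> r_gt0 nzf; rewrite prednK // size_poly_gt0 wpoly_eq0. Qed.

Lemma size_wpoly_leq r s f : (size (wpoly r s f) <= (wdeg r s f).+1)%N.
Proof. exact: leqSpred. Qed.

Lemma wlead_eq0 r s f : (0 < r)%N -> (wlead r s f == 0) = (f == 0).
Proof. by move=> r_gt0; rewrite lead_coef_eq0 wpoly_eq0. Qed.

Lemma wlead_coef r s f : wlead r s f = (wpoly r s f)`_(wdeg r s f).
Proof. by []. Qed.

Lemma wlead_intro r s f p (P : {poly K}) : P != 0 ->
  (forall d j, (p < d)%N -> (wpoly r s f)`_d`_j = 0) -> (wpoly r s f)`_p = P ->
  wdeg r s f = p /\ wlead r s f = P.
Proof.
move=> nzP H E.
have sz : size (wpoly r s f) = p.+1.
  apply/eqP; rewrite eqn_leq; apply/andP; split.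
    by apply/leq_sizeP => d lt_pd; apply/polyP => j; rewrite H // coef0.
  by rewrite ltnNge; apply: contra nzP => le_p; rewrite -E nth_default.
by rewrite wlead_coef /wdeg sz /= E.
Qed.

Definition wwronsk r s f h : {poly K} :=
  wronsk (wdeg r s f) (wdeg r s h) (wlead r s f) (wlead r s h).

Lemma wwronsk0 r s f : wwronsk r s f 0 = 0.
Proof.
rewrite /wwronsk /wronsk /wdeg /wlead rmorph0 size_poly0 lead_coef0 derivC.
by rewrite !mulr0 !mul0rn subrr.
Qed.

(** Compare the coefficients of t^(p + a) in [jac_wpoly]: on the left stands the Wronskian, on the
    right r times the component of {f, h} of weight p + a - (r + s). *)
Lemma wlead_pbracket r s f h : (0 < r)%N -> wwronsk r s f h != 0 ->
  [/\ pbracket f h != 0,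
      (wdeg r s (pbracket f h) + (r + s) = wdeg r s h + wdeg r s f)%N &
      wwronsk r s f h = r%:R *: wlead r s (pbracket f h)].
Proof.
move=> r_gt0 nzW.
set p := wdeg r s f; set a := wdeg r s h; set e := (r + s)%N; set B := pbracket f h.
have E := jac_wpoly r s f h.
have top := coef_jac_top (size_wpoly_leq r s f) (size_wpoly_leq r s h).
have above k : (p + a < k)%N -> ('X * jac (wpoly r s f) (wpoly r s h))`_k = 0.
  (* [coef_jac_top] asks only for upper bounds on sizes, so it applies with k - a > p in place of p,
     where the coefficient of f is 0. *)
  move=> lt_k; have -> : k = ((k - a) + a)%N by lia.
  have le_p : (size (wpoly r s f) <= (k - a).+1)%N.
    by rewrite (leq_trans (size_wpoly_leq r s f)) // ltnS -/p; lia.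
  rewrite (coef_jac_top le_p (size_wpoly_leq r s h)) /wronsk.
  rewrite [(wpoly r s f)`__]nth_default; first by rewrite deriv0 !mul0r !mul0rn subrr.
  by rewrite (leq_trans (size_wpoly_leq r s f)) // -/p; lia.
have coefE k : ('X * jac (wpoly r s f) (wpoly r s h))`_(k + e) = (wpoly r s B)`_k *+ r.
  by rewrite E coefMn coefXnM ltnNge leq_addl addnK.
have le_e : (e <= p + a)%N.
  rewrite leqNgt; apply: contra nzW => lt_e.
  by rewrite /wwronsk -top E coefMn coefXnM lt_e mul0rn.
have EW : wwronsk r s f h = (wpoly r s B)`_(p + a - e) *+ r.
  by rewrite -coefE subnK // top.
have nzB : B != 0.
  by apply: contra nzW => /eqP B0; rewrite EW B0 rmorph0 coef0 mul0rn.
have le1 : (p + a - e <= wdeg r s B)%N.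
  rewrite -ltnS -(size_wpoly s r_gt0 nzB) ltnNge; apply: contra nzW => le1.
  by rewrite EW nth_default ?mul0rn.
have le2 : (wdeg r s B + e <= p + a)%N.
  rewrite leqNgt; apply/negP => lt1; have /eqP := above _ lt1.
  by rewrite coefE polyMn_eq0 // -wlead_coef wlead_eq0 // (negPf nzB).
have ED : (p + a - e = wdeg r s B)%N by lia.
split=> //; first by lia.
by rewrite EW ED scaler_nat wlead_coef.
Qed.

(** * Local nilpotency of {f, -} on K[f, g], and algebraic independence of f and g *)

Lemma iter_pbracket f g q N : pbracket f g = 1 ->
  iter N (pbracket f) (endo f g q) = endo f g (iter N (mderiv iY) q).
Proof. by move=> fg1; elim: N => //= N ->; rewrite pbracket_endol fg1 mulr1. Qed.

Lemma iter_mderiv_eq0 q N : (forall i j, (N <= j)%N -> q@_(mon2 i j) = 0) ->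
  iter N (mderiv iY) q = 0.
Proof.
elim: N q => [|N IH] q H; first by apply: mpoly2P => i j; rewrite H // mcoeff0.
by rewrite iterSr IH // => i j le_j; rewrite coef_mderivY H ?mul0rn.
Qed.

Lemma mcoeff_msize q i j : (msize q <= i + j)%N -> q@_(mon2 i j) = 0.
Proof.
move=> le_ij; apply/eqP; rewrite mcoeff_eq0; apply: msize_mdeg_ge.
by rewrite mdegE big_I2.
Qed.

Lemma pbracket_nilpotent f g q : pbracket f g = 1 ->
  exists N, iter N (pbracket f) (endo f g q) = 0.
Proof.
move=> fg1; exists (msize q); rewrite iter_pbracket // iter_mderiv_eq0 ?rmorph0 //.
by move=> i j le_j; rewrite mcoeff_msize // (leq_trans le_j) // leq_addl.
Qed.

Lemma mderiv0_const q : q^`M(iX) = 0 -> q^`M(iY) = 0 -> q = (q@_(mon2 0 0))%:MP.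
Proof.
move=> dX dY; apply: mpoly2P => i [|j]; rewrite mcoeffC2 ?andbT ?andbF.
  case: i => [|i] //=.
  have /(congr1 (mcoeff (mon2 i 0)))/eqP := dX; rewrite coef_mderivX mcoeff0.
  by rewrite (mulrn_eq0_char0 charK0) /= => /eqP.
have /(congr1 (mcoeff (mon2 i j)))/eqP := dY; rewrite coef_mderivY mcoeff0.
by rewrite (mulrn_eq0_char0 charK0) /= => /eqP.
Qed.

(** Bracketing q(f, g) = 0 with g and with f kills both partial derivatives of q at (f, g). These
    have smaller degree, hence vanish by induction, so q is a constant. *)
Lemma endo_inj0 f g q : pbracket f g = 1 -> endo f g q = 0 -> q = 0.
Proof.
move=> fg1; move: (leqnn (msize q)); move: {2}(msize q) => N.
move=> le_N; have {le_N} : forall i j, (N <= i + j)%N -> q@_(mon2 i j) = 0.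
  by move=> i j le_ij; rewrite mcoeff_msize // (leq_trans le_N).
elim: N q => [|N IH] q H E; first by apply: mpoly2P => i j; rewrite H // mcoeff0.
have dX : q^`M(iX) = 0.
  apply: IH => [i j le_ij|]; first by rewrite coef_mderivX H ?mul0rn // addSn.
  have := pbracket_endor f g q.
  by rewrite E pbracketC pbracket0 oppr0 fg1 mulr1 => <-.
have dY : q^`M(iY) = 0.
  apply: IH => [i j le_ij|]; first by rewrite coef_mderivY H ?mul0rn // addnS.
  by have := pbracket_endol f g q; rewrite E pbracket0 fg1 mulr1 => <-.
have Eq := mderiv0_const dX dY.
by rewrite Eq -(endoC f g) -Eq E.
Qed.

Lemma size_expM_leq (R : nzRingType) (F G : {poly R}) D N i j :
  (size F <= D.+1)%N -> (size G <= D.+1)%N -> (i < N)%N -> (j < N)%N ->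
  (size (F ^+ i * G ^+ j)%R <= (2 * N * D).+1)%N.
Proof.
move=> sF sG lt_i lt_j; apply: leq_trans (size_polyMleq _ _) _.
have := size_poly_exp_leq F i; have := size_poly_exp_leq G j.
have : ((size F).-1 * i <= D * N)%N by apply: leq_mul; [lia | exact: ltnW].
have : ((size G).-1 * j <= D * N)%N by apply: leq_mul; [lia | exact: ltnW].
by rewrite -mulnA [(N * D)%N]mulnC; lia.
Qed.

(* The polynomials in f and g of degree < N in each variable form a space of dimension N ^ 2,
   while a leading form that Poisson-commutes with that of f has its leading monomial
   on a ray, so that linearly many conditions suffice to exclude it. *)
Lemma exists_wwronsk_neq0 r s f g : (0 < r)%N -> pbracket f g = 1 -> (0 < wdeg r s f)%N ->
  exists q, wwronsk r s f (endo f g q) != 0.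
Proof.
move=> r_gt0 fg1 p_gt0.
set F := wpoly r s f; set G := wpoly r s g; set p := wdeg r s f.
set d := (size (wlead r s f)).-1.
have [D [sF sG]] : exists D, (size F <= D.+1)%N /\ (size G <= D.+1)%N.
  exists (maxn (size F) (size G)); split; rewrite leqW //; [exact: leq_maxl | exact: leq_maxr].
(* N is chosen so that N^2 > 2 N D + 1 = M, and M exceeds the weights of all f^i g^j with i, j <
   N. *)
pose N := (2 * D + 2)%N; pose M := (2 * N * D).+1.
(* The base N digits of k < N^2 encode the pair of exponents of f and g. *)
pose mon k := mon2 (k %/ N) (k %% N).
(* If the Wronskian vanishes, a leading form of weight a has degree a d / p; column a holds the
   coefficients at that place. *)
pose Mx : 'M[K]_(N * N, M) :=
  \matrix_(k, a) (F ^+ (k %/ N) * G ^+ (k %% N))`_a`_((a * d) %/ p).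
have : kermx Mx != 0.
  rewrite -mxrank_eq0 mxrank_ker subn_eq0 -ltnNge (leq_ltn_trans (rank_leq_col _)) //.
  rewrite /M /N; nia.
case/rowV0Pn => u /sub_kermxP uM nzu.
pose q : {mpoly K[2]} := \sum_(k < N * N) u 0 k *: 'X_[mon k].
have coefq (k : 'I_(N * N)) : q@_(mon k) = u 0 k.
  rewrite /q raddf_sum /= (bigD1 k) //= mcoeffZ mcoeffX eqxx mulr1 big1 ?addr0 // => k' ne_k.
  rewrite mcoeffZ mcoeffX /mon mon2_eq; case: eqP => [E1|]; rewrite ?mulr0 //=.
  case: eqP => [E2|]; rewrite ?mulr0 //; case/eqP: ne_k; apply: val_inj.
  by rewrite /= (divn_eq k N) (divn_eq k' N) E1 E2.
have nzq : q != 0.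
  apply: contra nzu => /eqP q0; apply/eqP/rowP => k; by rewrite -coefq q0 mcoeff0 mxE.
have Ew : wpoly r s (endo f g q) = \sum_(k < N * N) (u 0 k)%:P *: (F ^+ (k %/ N) * G ^+ (k %% N)).
  rewrite [endo f g q]rmorph_sum /= [LHS]rmorph_sum /=; apply: eq_bigr => k _.
  rewrite endoZ wpolyZ; congr (_ *: _).
  rewrite /endo comp_mpolyX big_I2 /= (tnth_nth 0) (tnth_nth 0) /=.
  by rewrite rmorphM !rmorphXn.
exists q; apply: contra nzq => /eqP W0; apply/eqP; apply: (endo_inj0 fg1).
apply/eqP; apply/negPn/negP => nzh; set h := endo f g q in W0 Ew nzh.
have nzf : f != 0.
  by apply: contraTneq p_gt0 => ->; rewrite /wdeg rmorph0 size_poly0.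
have sP : size (wlead r s f) = d.+1 by rewrite prednK // size_poly_gt0 wlead_eq0.
have sA : size (wlead r s h) = ((size (wlead r s h)).-1).+1.
  by rewrite prednK // size_poly_gt0 wlead_eq0.
have := wronsk_eq0_deg charK0 sP sA W0; set n := _.-1; set a := wdeg r s h => En.
have lt_aM : (a < M)%N.
  rewrite ltnS /a -ltnS -(size_wpoly s r_gt0 nzh) Ew.
  apply/leq_sizeP => j le_j; rewrite coef_sum big1 => // k _.
  have N_gt0 : (0 < N)%N by rewrite /N addn2.
  have sk : (size (F ^+ (k %/ N) * G ^+ (k %% N))%R <= j)%N.
    by apply: leq_trans le_j; apply: size_expM_leq; rewrite ?ltn_mod ?ltn_divLR.
  by rewrite coefZ (nth_default 0 sk) mulr0.
(* The column belonging to the weight of h forces its leading coefficient to be 0. *)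
have /rowP/(_ (Ordinal lt_aM)) := uM; rewrite !mxE /= => E0.
have : (wlead r s h)`_n = 0.
  have -> : n = ((a * d) %/ p)%N by rewrite -En mulKn.
  rewrite wlead_coef -/a Ew coef_sum coef_sum -[RHS]E0; apply: eq_bigr => k _.
  by rewrite coefZ coefCM mxE.
by apply/eqP; apply: coef_lead_size.
Qed.

(** Along the iterates of {f, -} the Wronskian starts nonzero and ends at 0; [h1] is the iterate
    just before it first vanishes. *)
Lemma wwronsk_chain r s f h N : (0 < r)%N -> iter N (pbracket f) h = 0 ->
  wwronsk r s f h != 0 ->
  exists h1, wwronsk r s f h1 != 0 /\ wwronsk r s f (pbracket f h1) = 0.
Proof.
move=> r_gt0; elim: N h => [|N IH] h; first by move=> /= -> ; rewrite wwronsk0 eqxx.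
move=> E nzW; case: (altP (wwronsk r s f (pbracket f h) =P 0)) => [W0|nzW1].
  by exists h; split; [exact: nzW | exact: W0].
by apply: IH nzW1; rewrite -iterSr.
Qed.

Section Weights.
Variables (r s : nat) (f : {mpoly K[2]}).
Hypotheses (r_gt0 : (0 < r)%N) (p_gt0 : (0 < wdeg r s f)%N) (Gf : Gamma' f).

Let nzf : f != 0.
Proof. by apply: contraTneq p_gt0 => ->; rewrite /wdeg rmorph0 size_poly0. Qed.

(** With A the leading form of h and B that of {f, h}, these are the hypotheses [EA], [EB], [nzB]
    and [eq_ab] of the bounds on roots. *)
Lemma wwronsk_witness : exists h,
  [/\ wwronsk r s f h = r%:R *: wlead r s (pbracket f h),
      wwronsk r s f (pbracket f h) = 0, wlead r s (pbracket f h) != 0 &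
      (wdeg r s h + wdeg r s f = wdeg r s (pbracket f h) + (r + s))%N].
Proof.
have [g fg1] := Gf; have [q nzW] := exists_wwronsk_neq0 r_gt0 fg1 p_gt0.
have [N nil] := pbracket_nilpotent q fg1.
have [h [nzWh W0]] := wwronsk_chain r_gt0 nil nzW.
have [nzB Edeg EW] := wlead_pbracket r_gt0 nzWh.
by exists h; rewrite wlead_eq0.
Qed.

Let sP : size (wlead r s f) = ((size (wlead r s f)).-1).+1.
Proof. by rewrite prednK // size_poly_gt0 wlead_eq0. Qed.

Lemma wlead_mup c : root (wlead r s f) c -> ((r + s) * mup c (wlead r s f) != wdeg r s f)%N.
Proof.
have [h [EW W0 nzB Edeg]] := wwronsk_witness.
have e_gt0 : (0 < r + s)%N by rewrite addn_gt0 r_gt0.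
exact: (mup_neq charK0 p_gt0 e_gt0 Edeg sP nzB (natr_neq0 r_gt0) EW W0).
Qed.

Lemma wlead_roots (cs : seq K) : uniq cs -> all (root (wlead r s f)) cs ->
  (size cs <= 1)%N \/ (size cs * wdeg r s f <= (r + s) * (size (wlead r s f)).-1)%N.
Proof.
have [h [EW W0 nzB Edeg]] := wwronsk_witness.
have e_gt0 : (0 < r + s)%N by rewrite addn_gt0 r_gt0.
exact: (size_roots charK0 p_gt0 e_gt0 Edeg sP nzB (natr_neq0 r_gt0) EW W0).
Qed.

End Weights.
End JacobianPairs.

(** * Automorphisms have no rectangular component *)

Section TotalDegree.
Variable K : closedFieldType.
Hypothesis charK0 : [pchar K] =i pred0.
Implicit Types f g h q : {mpoly K[2]}.

Notation x := ('X_iX : {mpoly K[2]}).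
Notation y := ('X_iY : {mpoly K[2]}).

Lemma mcoeff_wdeg11 f i j : (wdeg 1 1 f < i + j)%N -> f@_(mon2 i j) = 0.
Proof.
move=> lt_d; rewrite -coef_wpoly11 [(wpoly 1 1 f)`__]nth_default ?coef0 //.
exact: leq_trans (size_wpoly_leq 1 1 f) lt_d.
Qed.

Lemma coef_wlead11 f j :
  (wlead 1 1 f)`_j = if (j <= wdeg 1 1 f)%N then f@_(mon2 (wdeg 1 1 f - j) j) else 0.
Proof. by rewrite wlead_coef coef_wpoly // mul1n dvd1n andbT divn1. Qed.

Lemma Gamma'_wdeg11 f : Gamma' f -> (0 < wdeg 1 1 f)%N.
Proof.
case=> g fg1; rewrite lt0n; apply/negP => /eqP d0.
have dX : f^`M(iX) = 0.
  by apply: mpoly2P => i j; rewrite coef_mderivX mcoeff_wdeg11 ?d0 ?mul0rn ?mcoeff0.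
have dY : f^`M(iY) = 0.
  by apply: mpoly2P => i j; rewrite coef_mderivY mcoeff_wdeg11 ?d0 ?mul0rn ?mcoeff0 ?addnS.
by move/eqP: fg1; rewrite /pbracket dX dY !mul0r subrr eq_sym oner_eq0.
Qed.

(** In the rectangle below (k, n) the corner is the only point of total degree k + n. *)
Lemma S1_wlead k n f : S1 k n f ->
  wdeg 1 1 f = (k + n)%N /\ wlead 1 1 f = f@_(mon2 k n) *: 'X^n.
Proof.
case=> nzc H; apply: wlead_intro.
- by rewrite -size_poly_eq0 size_scale // size_polyXn.
- move=> d j lt_d; apply: coef_wpoly0 => // i Ed; apply: H; lia.
apply/polyP => j; rewrite coefZ coefXn; case: eqP => [->|ne_j].
  by rewrite coef_wpoly11 mulr1.
by rewrite mulr0; apply: coef_wpoly0 => // i Ed; apply: H; lia.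
Qed.

Lemma wronsk_monomials p a n m (c d : K) :
  'X * wronsk p a (c *: 'X^n) (d *: 'X^m) =
  (c * d * ((p * m)%:R - (a * n)%:R)) *: 'X^(n + m).
Proof.
have DX i : 'X * ('X^i)^`() = 'X^i *+ i :> {poly K}.
  by rewrite derivXn mulrnAr; case: i => [|i]; rewrite ?mulr0n -?exprS.
rewrite /wronsk !derivZ -!mul_polyC.
transitivity (c%:P * d%:P * ('X^n * ('X * ('X^m)^`()) *+ p - 'X * ('X^n)^`() * 'X^m *+ a)).
  by ring.
have CN i : (i%:R : K)%:P = i%:R :> {poly K} by rewrite rmorph_nat.
by rewrite !DX !polyCM polyCB !CN exprD !natrM; ring.
Qed.

(** Each bracket adds k + n - 2 to the degree and n - 1 to the exponent of Y. The scalar gained at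
    step s is c c' times (k + n) s (n - 1) - (1 + s (k + n - 2)) n = - (n + s (k - n)), which is
    nonzero as k > n > 0. *)
Lemma iter_pbracket_wlead f k n c s : (0 < n)%N -> (n < k)%N -> c != 0 ->
  wdeg 1 1 f = (k + n)%N -> wlead 1 1 f = c *: 'X^n ->
  wdeg 1 1 (iter s (pbracket f) x) = (1 + s * (k + n - 2))%N /\
  exists2 c', c' != 0 & wlead 1 1 (iter s (pbracket f) x) = c' *: 'X^(s * n.-1).
Proof.
move=> n_gt0 lt_nk nzc Edeg Elead; elim: s => [|s [IHdeg [c' nzc' IHlead]]].
  have Ex : wpoly 1 1 x = 'X by rewrite wpoly_x expr1.
  split; first by rewrite /wdeg /= Ex size_polyX.
  by exists 1; rewrite ?oner_neq0 // /wlead /= Ex lead_coefX mul0n expr0 scale1r.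
set h := iter s (pbracket f) x in IHdeg IHlead *; rewrite [iter s.+1 _ _]/= -/h.
have EW := wronsk_monomials (k + n) (1 + s * (k + n - 2)) n (s * n.-1) c c'.
rewrite -Elead -IHlead -IHdeg -Edeg -/(wwronsk 1 1 f h) in EW.
set c2 := c * c' * _ in EW.
have nzc2 : c2 != 0.
  rewrite !mulf_neq0 // subr_eq0 (natr_inj0 charK0) Edeg IHdeg.
  case: n n_gt0 lt_nk {Elead EW c2 IHlead Edeg IHdeg} => // n _ lt_nk; rewrite [n.+1.-1]/=.
  apply/eqP; have -> : (k + n.+1 - 2 = k + n - 1)%N by lia.
  case: k lt_nk => [|k] lt_nk; first by lia.
  have -> : (k.+1 + n - 1 = k + n)%N by lia.
  nia.
have nzW : wwronsk 1 1 f h != 0.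
  apply: contra nzc2 => /eqP W0; move/eqP: EW.
  by rewrite W0 mulr0 eq_sym scaler_eq0 -size_poly_eq0 size_polyXn orbF.
have [nzB EdegB EWB] := wlead_pbracket charK0 (ltnSn 0) nzW.
split; first by move: EdegB; rewrite IHdeg Edeg; lia.
exists c2 => //; move: EW; rewrite EWB scale1r.
have -> : (n + s * n.-1 = (s.+1 * n.-1).+1)%N by rewrite mulSn; lia.
by rewrite exprS scalerAr => /(mulfI (negbT (polyX_eq0 _))).
Qed.

Lemma JC2_S1_Gamma' k n f : JC2 K -> (n < k)%N -> (0 < n)%N -> S1 k n f -> ~ Gamma' f.
Proof.
move=> JC lt_nk n_gt0 Sf [g fg1].
have [|inv _ invK] := JC f g; first by exists 1; rewrite ?oner_neq0 ?mpolyC1.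
have [Edeg Elead] := S1_wlead Sf.
(* Surjectivity gives X = q(f, g) with q = [inv x], so some iterate of {f, -} kills X. *)
have [N] := pbracket_nilpotent (inv x) fg1; rewrite invK => nil.
have [_ [c nzc]] := iter_pbracket_wlead N n_gt0 lt_nk Sf.1 Edeg Elead.
rewrite nil /wlead rmorph0 lead_coef0 => /esym/eqP.
by rewrite scaler_eq0 (negPf nzc) -size_poly_eq0 size_polyXn.
Qed.

End TotalDegree.

(** * Elementary automorphisms *)

(** The ratios a / b are compared by cross multiplication; the minimum selects the slope of an edge
    in [edge]. *)
Lemma min_ratio (T : eqType) (ts : seq T) (a b : T -> nat) :
  ts != [::] -> {in ts, forall t, 0 < b t}%N ->
  exists2 t, t \in ts & {in ts, forall t', a t * b t' <= a t' * b t}%N.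
Proof.
elim: ts => // t1 ts IH _ b_gt0; have b1 := b_gt0 t1 (mem_head _ _).
have [->|nz] := eqVneq ts [::].
  by exists t1; rewrite ?mem_head // => t'; rewrite inE => /eqP ->.
have [|t t_ts min_t] := IH nz; first by move=> t ts_t; apply: b_gt0; rewrite inE ts_t orbT.
have bt : (0 < b t)%N by apply: b_gt0; rewrite inE t_ts orbT.
have [le_t|le_t] := leqP (a t * b t1) (a t1 * b t).
  exists t; first by rewrite inE t_ts orbT.
  by move=> t'; rewrite inE => /predU1P[->|/min_t].
exists t1; rewrite ?mem_head // => t'; rewrite inE => /predU1P[->//|ts_t'].
rewrite -(leq_pmul2l bt).
have h1 : (a t1 * b t * b t' <= a t * b t1 * b t')%N by rewrite leq_mul2r ltnW ?orbT.
have h2 : (a t * b t' * b t1 <= a t' * b t * b t1)%N by rewrite leq_mul2r min_t ?orbT.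
nia.
Qed.

Section Reduction.
Variable K : closedFieldType.
Hypothesis charK0 : [pchar K] =i pred0.
Implicit Types f g h q u v : {mpoly K[2]}.

Notation x := ('X_iX : {mpoly K[2]}).
Notation y := ('X_iY : {mpoly K[2]}).

Lemma single_root (P : {poly K}) : P != 0 ->
  (forall cs, uniq cs -> all (root P) cs -> (size cs <= 1)%N) ->
  exists z, P = lead_coef P *: ('X - z%:P) ^+ (size P).-1.
Proof.
move=> nzP H; have [rs E] := closed_field_poly_normal P.
have sP : size P = (size rs).+1 by rewrite E size_scale ?lead_coef_eq0 // size_prod_XsubC.
have le1 : (size (undup rs) <= 1)%N.
  apply: H (undup_uniq _) _; apply/allP => z; rewrite mem_undup E => z_rs.
  by rewrite rootZ ?lead_coef_eq0 // root_prod_XsubC.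
exists (head 0 rs); rewrite {1}E sP /=; congr (_ *: _).
have : all (pred1 (head 0 rs)) rs.
  apply/allP => z z_rs /=; have h_rs : head 0 rs \in rs by case: (rs) z_rs => //= *; rewrite mem_head.
  move: z_rs h_rs; rewrite -!(mem_undup rs).
  by case: (undup rs) le1 => [|w [|]] // _; rewrite !inE => /eqP -> /eqP ->.
by move/all_pred1P => {1}->; rewrite big_nseq -Monoid.iteropE.
Qed.

(** For the weights 1 and s the substitution is homogeneous, and at X = 1 it becomes Y -> Y + z. *)
Lemma wlead_shift s z f :
  wdeg 1 s (endo x (y + z *: x ^+ s) f) = wdeg 1 s f /\
  wlead 1 s (endo x (y + z *: x ^+ s) f) = wlead 1 s f \Po ('X + z%:P).
Proof.
have E : wpoly 1 s (endo x (y + z *: x ^+ s) f) = map_poly (comp_poly ('X + z%:P)) (wpoly 1 s f).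
  elim/mpoly2_ind: f => [c|||f g Ef Eg|f g Ef Eg].
  - by rewrite endoC wpolyC map_polyC /= comp_polyC.
  - by rewrite endo_x wpoly_x map_polyXn.
  - rewrite endo_y rmorphD /= wpolyZ rmorphXn /= wpoly_y wpoly_x expr1.
    by rewrite rmorphM /= map_polyC map_polyXn /= comp_polyX polyCD mulrDl -mul_polyC.
  - by rewrite !rmorphD /= Ef Eg.
  - by rewrite !rmorphM /= Ef Eg.
have inj : injective (comp_poly ('X + z%:P)).
  move=> P Q /(congr1 (comp_poly ('X - z%:P))).
  rewrite -!comp_polyA.
  have -> : ('X + z%:P) \Po ('X - z%:P) = 'X by rewrite comp_polyD comp_polyX comp_polyC subrK.
  by rewrite !comp_polyXr.
split; first by rewrite /wdeg E size_map_inj_poly ?comp_poly0.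
by rewrite /wlead E lead_coef_map_inj ?comp_poly0.
Qed.

Lemma wdeg11_swap f : wdeg 1 1 (endo y x f) = wdeg 1 1 f.
Proof.
have le g : (size (wpoly 1 1 (endo y x g)) <= size (wpoly 1 1 g))%N.
  apply/leq_sizeP => d le_d; apply/polyP => j; rewrite coef0.
  apply: coef_wpoly0 => // i; rewrite !mul1n => Ed.
  by rewrite coef_swap -coef_wpoly11 addnC -Ed [(wpoly 1 1 g)`__]nth_default // coef0.
congr (_.-1); apply: anti_leq; apply/andP; split; first exact: le.
by have := le (endo y x f); rewrite endo_comp endo_x endo_y endo_id.
Qed.

Definition tame u v := bijective (endo u v) /\ exists2 c : K, c != 0 & pbracket u v = c%:MP.

(** A property of f alone, so that the induction can run on the degree of f. *)
Definition completes f :=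
  forall g (c : K), c != 0 -> pbracket f g = c%:MP -> bijective (endo f g).

Lemma tame_swap : tame y x.
Proof.
split; first by exists (endo y x) => f; rewrite endo_comp endo_x endo_y endo_id.
exists (-1); first by rewrite oppr_eq0 oner_eq0.
by rewrite pbracketC /pbracket !mderivU /= mulr1 mulr0 subr0 mpolyCN mpolyC1.
Qed.

Lemma tame_shear s (z : K) : tame x (y + z *: x ^+ s).
Proof.
have K' w : cancel (endo x (y + w *: x ^+ s)) (endo x (y + (- w) *: x ^+ s)).
  move=> f; rewrite endo_comp endo_x rmorphD /= endo_y endoZ rmorphXn /= endo_x.
  by rewrite -addrA -scalerDl addNr scale0r addr0 endo_id.
split; first by exists (endo x (y + (- z) *: x ^+ s)) => // f; have := K' (- z) f; rewrite opprK.
exists 1; rewrite ?oner_neq0 // /pbracket mderivD !mderivU mderivZ mpolyXn mderivX /=.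
by rewrite mulmnE mnm1E /= mul0n scale0r scaler0 mul0r subr0 addr0 mulr1 mpolyC1.
Qed.

(** The endomorphism of the substituted pair is [endo u v] after [endo f g], so composing with the
    inverse of [endo u v] recovers [endo f g]. *)
Lemma completes_endo u v f : tame u v -> completes (endo u v f) -> completes f.
Proof.
case=> [bij_uv [c nzc Euv]] H g d nzd Efg.
have bij2 : bijective (endo (endo u v f) (endo u v g)).
  by apply: (H _ (d * c)); rewrite ?mulf_neq0 // pbracket_endo Efg Euv endoC mpolyCM.
have [w wK Kw] := bij_uv.
have Kw' : bijective w by exists (endo u v).
apply: (eq_bij (bij_comp Kw' bij2)) => p /=.
by rewrite -endo_comp wK.
Qed.

Lemma Gamma'P f g c : c != 0 -> pbracket f g = c%:MP -> Gamma' f.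
Proof.
move=> nzc E; exists (c^-1 *: g); rewrite pbracketZr E -mul_mpolyC -mpolyCM mulVf ?mpolyC1 //.
Qed.

Lemma Gamma'_endo u v f : tame u v -> Gamma' f -> Gamma' (endo u v f).
Proof.
case=> [_ [c nzc Euv]] [g fg1]; apply: (@Gamma'P _ (endo u v g) c nzc).
by rewrite pbracket_endo fg1 rmorph1 mul1r.
Qed.

End Reduction.

(** * Degree reduction *)

(** If c >= 2, then 2 s d <= 2 p <= (r + s) d, which forces d = 0 as r < s, and then p = 0. *)
Lemma leq1_of_slopes r s d p c :
  (0 < p)%N -> (r < s)%N -> (s * d <= p)%N -> (c * p <= (r + s) * d)%N -> (c <= 1)%N.
Proof.
move=> p_gt0 lt_rs le_p le_c; rewrite leqNgt; apply/negP => gt1.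
have h1 : (2 * p <= c * p)%N by rewrite leq_mul2r gt1 orbT.
have h2 : (r.+1 * d <= s * d)%N by rewrite leq_mul2r lt_rs orbT.
move: le_c h2; rewrite mulnDl mulSn => le_c h2; have [d0|d_gt0] := posnP d; last by lia.
by move: le_c; rewrite d0 !muln0; lia.
Qed.

Lemma XsubC_exp_shift (R : comNzRingType) (z : R) d :
  ('X - z%:P) ^+ d \Po ('X + z%:P) = 'X^d.
Proof. by rewrite rmorphXn /= comp_polyB comp_polyX comp_polyC addrK. Qed.

Section Backward.
Variable K : closedFieldType.
Hypothesis charK0 : [pchar K] =i pred0.
Implicit Types f g h q u v : {mpoly K[2]}.

Notation x := ('X_iX : {mpoly K[2]}).
Notation y := ('X_iY : {mpoly K[2]}).

Lemma endo_mderivY0 u v w h : h^`M(iY) = 0 -> endo u v h = endo u w h.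
Proof.
move=> dY; rewrite !endoE; apply: eq_big_seq => m; rewrite mcoeff_msupp (mon2E m) mon2X mon2Y.
case: (m iY) => [|j]; first by rewrite !expr0.
have /(congr1 (mcoeff (mon2 (m iX) j)))/eqP := dY; rewrite coef_mderivY mcoeff0.
by rewrite (mulrn_eq0_char0 charK0) /= => E /negP[].
Qed.

(** The bracket reduces to f_X g_Y, and the factors of a nonzero constant are constants. So f = a X
    + d and g = b Y + h(X), a triangular pair with an explicit inverse. *)
Lemma completes_univariate f : f^`M(iY) = 0 -> completes f.
Proof.
move=> dYf g c nzc; rewrite /pbracket dYf mul0r subr0 => E.
have const h : size (wpoly 1 1 h) == 1%N -> h = (h@_(mon2 0 0))%:MP.
  move=> /eqP sh; apply: mpoly2P => i j; rewrite mcoeffC2.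
  case: i j => [|i] [|j] //=; rewrite mcoeff_wdeg11 // /wdeg sh //.
have /andP[/const Ea /const Eb] :
    (size (wpoly 1 1 f^`M(iX)) == 1%N) && (size (wpoly 1 1 g^`M(iY)) == 1%N).
  by rewrite -size_mul_eq1 -rmorphM E /= wpolyC size_polyC polyC_eq0 nzc.
set a := _@_ _ in Ea; set b := _@_ _ in Eb.
have /andP[nza nzb] : (a != 0) && (b != 0).
  rewrite -negb_or -mulf_eq0; move: nzc; congr (_ != 0).
  by move: E; rewrite Ea Eb -mpolyCM => /(congr1 (mcoeff 0%MM)); rewrite !mcoeffC eqxx !mulr1.
have alg1 (e : K) : e *: 1 = e%:MP :> {mpoly K[2]} by rewrite -mul_mpolyC mulr1.
have := @mderiv0_const K charK0 (f - a *: x); rewrite !mderivB !mderivZ !mderivU dYf Ea /=.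
rewrite alg1 subrr scaler0 subr0 => /(_ erefl erefl).
set d := _@_ _ => /eqP; rewrite subr_eq => /eqP Ef.
pose h := g - b *: y.
have dYh : h^`M(iY) = 0 by rewrite mderivB mderivZ mderivU Eb /= alg1 subrr.
have Eg : g = b *: y + h by rewrite addrC subrK.
pose u := a^-1 *: (x - d%:MP); pose v := b^-1 *: (y - endo u y h).
have fgu : endo f g u = x.
  by rewrite endoZ rmorphB /= endo_x endoC Ef addrAC subrr add0r scalerA mulVf ?scale1r.
have uvf : endo u v f = x.
  by rewrite Ef rmorphD /= endoC endoZ endo_x scalerA divff ?scale1r // addrC subrK.
have fgv : endo f g v = y.
  rewrite endoZ rmorphB /= endo_y endo_comp fgu endo_y (endo_mderivY0 _ _ y dYh) endo_id.
  by rewrite {1}Eg addrK scalerA mulVf ?scale1r.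
have uvg : endo u v g = y.
  rewrite {1}Eg rmorphD /= endoZ endo_y (endo_mderivY0 _ _ y dYh) scalerA divff ?scale1r //.
  by rewrite subrK.
by exists (endo u v) => p; rewrite endo_comp ?uvf ?uvg ?fgu ?fgv endo_id.
Qed.

(** The edge leaves the vertex (k, n) towards larger exponents of Y: it passes through a monomial
    (i1, j1) with j1 > n and (k - i1) / (j1 - n) minimal, and its normal (j1 - n, k - i1) gives the
    weights. *)
Lemma edge f k n c : Gamma' f -> (0 < k)%N -> c != 0 ->
  wdeg 1 1 f = (k + n)%N -> wlead 1 1 f = c *: 'X^n ->
  (exists i j, (n < j)%N /\ f@_(mon2 i j) != 0) ->
  exists r s, [/\ (0 < r)%N, (r < s)%N, wdeg r s f = (r * k + s * n)%N &
    let P := wlead r s f in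
    [/\ forall j, (j < n)%N -> P`_j = 0, P`_n != 0 & exists2 j, (n < j)%N & P`_j != 0]].
Proof.
move=> Gf k_gt0 nzc Edeg Elead [i0 [j0 [lt_nj0 nz0]]].
(* The leading form is a single monomial, so all others have smaller total degree; in particular j >
   n implies i < k, and the truncated differences below are exact. *)
have below i j : f@_(mon2 i j) != 0 -> (i + j < k + n)%N \/ (i = k /\ j = n).
  move=> nz; have := leq_total (i + j).+1 (k + n); rewrite leqNgt ltnS.
  case: (ltngtP (i + j) (k + n)) => [|lt|eq] _; [by left | | right].
    by move: nz; rewrite mcoeff_wdeg11 ?Edeg ?eqxx.
  have : (wlead 1 1 f)`_j = f@_(mon2 i j).
    by rewrite coef_wlead11 Edeg -eq leq_addl addnK.
  rewrite Elead coefZ coefXn; case: eqP => [E _|_ E]; first by split=> //; lia.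
  by move: nz; rewrite -E mulr0 eqxx.
pose ts := [seq m : 'X_{1..2} <- msupp f | (n < m iY)%N].
have ts_P m : (m \in ts) = (n < m iY)%N && (f@_m != 0) by rewrite mem_filter mcoeff_msupp.
have [|m m_ts|m m_ts min_m] := @min_ratio 'X_{1..2} ts (fun m => k - m iX)%N (fun m => m iY - n)%N.
- have : mon2 i0 j0 \in ts by rewrite ts_P mon2Y lt_nj0.
  by case: (ts).
- by move: m_ts; rewrite ts_P subn_gt0 => /andP[].
move: m_ts; rewrite ts_P {1}(mon2E m) {3}(mon2E m) mon2Y.
set i1 := m iX in min_m *; set j1 := m iY in min_m *.
case/andP=> lt_nj1 nz1.
have lt1 : (i1 + j1 < k + n)%N by case: (below _ _ nz1) => // -[_ E]; lia.
exists (j1 - n)%N, (k - i1)%N.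
set r := (j1 - n)%N; set s := (k - i1)%N.
have r_gt0 : (0 < r)%N by rewrite subn_gt0.
have lt_rs : (r < s)%N by rewrite /r /s; lia.
(* All monomials lie on or below the line through (k, n) and (i1, j1): for j > n by minimality, for
   j <= n because s > r and i + j <= k + n. *)
have bound i j : f@_(mon2 i j) != 0 ->
    (r * i + s * j <= r * k + s * n)%N /\ ((j < n)%N -> (r * i + s * j < r * k + s * n)%N).
  move=> nz; have le_ij : (i + j <= k + n)%N by case: (below _ _ nz) => [|[-> ->]] //; exact: ltnW.
  have [lt_nj|le_jn] := ltnP n j.
    have : mon2 i j \in ts by rewrite ts_P mon2Y lt_nj.
    move/min_m; rewrite mon2X mon2Y -/r -/s => H; split; last by lia.
    have lt_ik : (i < k)%N by lia.
    have -> : k = (i + (k - i))%N by lia.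
    have -> : j = (n + (j - n))%N by lia.
    rewrite !mulnDr; lia.
  have h1 : (r * i + r * j <= r * k + r * n)%N by rewrite -!mulnDr leq_mul2l le_ij orbT.
  have E : s = (r + (s - r))%N by lia.
  have h2 : ((s - r) * j <= (s - r) * n)%N by rewrite leq_mul2l le_jn orbT.
  have h3 : (j < n -> (s - r) * j < (s - r) * n)%N by rewrite ltn_mul2l subn_gt0 lt_rs.
  by rewrite E !mulnDl; split=> [|/h3]; lia.
have nzkn : f@_(mon2 k n) != 0.
  have := coef_wlead11 f n; rewrite Edeg leq_addl addnK => <-.
  by rewrite Elead coefZ coefXn eqxx mulr1.
have [ED EP] : wdeg r s f = (r * k + s * n)%N /\ wlead r s f = (wpoly r s f)`_(r * k + s * n).
  apply: wlead_intro => //.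
    apply: contra nzkn => /eqP P0; by rewrite -(coef_wpoly_mon2 s f k n r_gt0) P0 coef0.
  move=> d j lt_d; apply: coef_wpoly0 => // i Ed; apply/eqP; apply: contraLR lt_d => nz.
  by rewrite -leqNgt Ed; case: (bound _ _ nz).
split=> //; rewrite EP; split.
- move=> j lt_jn; apply: coef_wpoly0 => // i Ed; apply/eqP; apply: contraTT lt_jn => nz.
  by apply/negP => lt_jn; have [_ /(_ lt_jn)] := bound _ _ nz; rewrite Ed ltnn.
- by rewrite coef_wpoly_mon2.
exists j1 => //.
have -> : (r * k + s * n = r * i1 + s * j1)%N.
  have -> : k = (i1 + s)%N by rewrite /s; lia.
  have -> : j1 = (n + r)%N by rewrite /r; lia.
  by rewrite !mulnDr; lia.
by rewrite coef_wpoly_mon2.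
Qed.

Lemma edge_root f r s : Gamma' f -> (0 < r)%N -> (r < s)%N -> (0 < wdeg r s f)%N ->
  exists z, wlead r s f = lead_coef (wlead r s f) *: ('X - z%:P) ^+ (size (wlead r s f)).-1.
Proof.
move=> Gf r_gt0 lt_rs p_gt0; set P := wlead r s f.
have nzP : P != 0.
  rewrite wlead_eq0 //; apply: contraTneq p_gt0 => ->; by rewrite /wdeg rmorph0 size_poly0.
apply: single_root => // cs us rs.
case: (wlead_roots charK0 r_gt0 p_gt0 Gf us rs) => //; rewrite -/P.
(* The top coefficient of P comes from a monomial of f with Y-exponent d, whence s d <=
   [wdeg r s f]. *)
have : lead_coef P != 0 by rewrite lead_coef_eq0.
rewrite lead_coefE; set d := (size P).-1; rewrite /P wlead_coef coef_wpoly //.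
case: ifP => [/andP[le_d _] _|]; last by rewrite eqxx.
exact: leq1_of_slopes.
Qed.

(** As n > 0, the form of an edge vanishes at 0, so 0 is its single root and it is a monomial; but
    its lowest exponent is n and its degree exceeds n. *)
Lemma no_edge f k n c : Gamma' f -> (0 < k)%N -> (0 < n)%N -> c != 0 ->
  wdeg 1 1 f = (k + n)%N -> wlead 1 1 f = c *: 'X^n ->
  forall i j, (n < j)%N -> f@_(mon2 i j) = 0.
Proof.
move=> Gf k_gt0 n_gt0 nzc Edeg Elead i j lt_nj; apply/eqP/negPn/negP => nz.
have [|r [s [r_gt0 lt_rs ED [P0 Pn [j1 lt_nj1 Pj]]]]] := edge Gf k_gt0 nzc Edeg Elead.
  by exists i, j.
have p_gt0 : (0 < wdeg r s f)%N by rewrite ED addn_gt0 muln_gt0 r_gt0 k_gt0.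
have [z] := edge_root Gf r_gt0 lt_rs p_gt0; set P := wlead r s f in P0 Pn Pj *.
set d := (size P).-1 => EP.
have lt_d : (n < d)%N.
  rewrite (leq_trans lt_nj1) // /d -ltnS; apply: contraR Pj; rewrite -leqNgt => le_j.
  by rewrite nth_default // (leq_trans (leqSpred _)).
have z0 : z = 0.
  have : P.[0] = 0 by rewrite horner_coef0 P0.
  rewrite EP !hornerE => /eqP; rewrite mulf_eq0 expf_eq0 oppr_eq0.
  case/orP => [/eqP lc0|/andP[_ /eqP //]].
  by move: Pn; rewrite EP lc0 scale0r coef0 eqxx.
by move: Pn; rewrite EP z0 subr0 coefZ coefXn (ltn_eqF lt_d) mulr0 eqxx.
Qed.

Lemma completes_pure f k c : Gamma' f -> (0 < k)%N -> c != 0 ->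
  wdeg 1 1 f = k -> wlead 1 1 f = c%:P ->
  (forall h, Gamma' h -> (wdeg 1 1 h < k)%N -> completes h) -> completes f.
Proof.
move=> Gf k_gt0 nzc Edeg Elead IH.
have [dY|nz_dY] := eqVneq f^`M(iY) 0; first exact: completes_univariate.
have ex : exists i j, (0 < j)%N /\ f@_(mon2 i j) != 0.
  move: nz_dY; rewrite -msupp_eq0; case E: (msupp _) => [|m ms] // _.
  have : m \in msupp f^`M(iY) by rewrite E mem_head.
  rewrite mcoeff_msupp (mon2E m) coef_mderivY => nz; exists (m iX), (m iY).+1; split=> //.
  by apply: contra nz => /eqP ->; rewrite mul0rn.
have [||r [s [r_gt0 lt_rs ED [_ Pn [j1 lt_nj1 Pj]]]]] := @edge f k 0 c Gf k_gt0 nzc _ _ ex.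
- by rewrite addn0.
- by rewrite Elead expr0 alg_polyC.
rewrite muln0 addn0 in ED.
have p_gt0 : (0 < wdeg r s f)%N by rewrite ED muln_gt0 r_gt0.
have [z] := edge_root Gf r_gt0 lt_rs p_gt0; set P := wlead r s f in Pn Pj *.
set d := (size P).-1; set l := lead_coef P => EP.
have nzl : l != 0 by apply: contra Pn => /eqP l0; rewrite EP l0 scale0r coef0.
have d_gt0 : (0 < d)%N.
  rewrite (leq_trans lt_nj1) // /d -ltnS; apply: contraR Pj; rewrite -leqNgt => le_j.
  by rewrite nth_default // (leq_trans (leqSpred _)).
have nzz : z != 0.
  apply: contra Pn => /eqP z0; rewrite EP z0 subr0 coefZ coefXn.
  by rewrite (ltn_eqF d_gt0) mulr0.
(* As l, z and d are nonzero, l (Y - z)^d has a linear term. It comes from a monomial with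
   X-exponent (r k - s) / r, so r divides s. *)
have P1 : P`_1 != 0.
  have -> : P`_1 = (P^`()).[0] by rewrite horner_coef0 coef_deriv mulr1n.
  rewrite EP derivZ deriv_exp derivB derivX derivC subr0 mul1r !(hornerE, hornerMn).
  by rewrite mulf_neq0 // (mulrn_eq0_char0 charK0) negb_or -lt0n d_gt0 expf_neq0 ?oppr_eq0.
have : (r %| s)%N.
  move: P1; rewrite /P wlead_coef ED coef_wpoly // muln1; case: ifP; last by rewrite eqxx.
  by case/andP=> le_s; rewrite dvdn_subr ?dvdn_mulr.
case/dvdnP => t Es.
have t_gt1 : (1 < t)%N by move: lt_rs; rewrite Es -{1}[r]mul1n ltn_mul2r => /andP[].
(* The weights (r, s) = (r, t r) are r times (1, t). *)
have Ew e j : (wpoly 1 t f)`_e`_j = (wpoly r s f)`_(r * e)`_j.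
  rewrite !coef_wpoly // Es mulnAC [(t * j * r)%N]mulnC -mulnBr leq_pmul2l // dvd1n divn1.
  by rewrite dvdn_mulr // mulKn.
have [ED1 EP1] : wdeg 1 t f = k /\ wlead 1 t f = P.
  apply: wlead_intro.
  - by apply: contra Pn => /eqP ->; rewrite coef0.
  - move=> e j lt_e; rewrite Ew; apply/eqP; rewrite [(wpoly _ _ f)`__]nth_default ?coef0 //.
    by rewrite (leq_trans (size_wpoly_leq _ _ _)) // ED ltn_pmul2l.
  - by apply/polyP => j; rewrite Ew -ED -wlead_coef.
pose f1 := endo x (y + z *: x ^+ t) f.
have [] := wlead_shift t z f; rewrite -/f1 ED1 EP1 => ED2 EP2.
have {EP2} EP2 : wlead 1 t f1 = l *: 'X^d.
  by rewrite EP2 {1}EP comp_polyZ XsubC_exp_shift.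
apply: (completes_endo (tame_shear t z)); apply: IH; first exact: Gamma'_endo (tame_shear t z) Gf.
(* For the weights (1, t) the leading form of [f1] is l Y^d with d > 0. A monomial of total degree
   at least k would satisfy i + t j = k, hence j = 0 as t > 1, but X^k no longer occurs. *)
suff sz : (size (wpoly 1 1 f1) <= k)%N.
  by rewrite -/f1 /wdeg; case: (size _) sz.
apply/leq_sizeP => e le_ke; apply/polyP => j; rewrite coef0; apply: coef_wpoly0 => // i.
rewrite !mul1n => Ee; rewrite -(coef_wpoly_mon2 t f1 i j (ltn0Sn 0)) mul1n.
have le_e : (k <= i + t * j)%N by rewrite (leq_trans le_ke) // Ee leq_add2l leq_pmull // ltnW.
have [Ek|lt_k] := eqVneq k (i + t * j)%N; last first.
  rewrite [(wpoly _ _ f1)`__]nth_default ?coef0 // (leq_trans (size_wpoly_leq _ _ _)) //.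
  by rewrite ED2 ltn_neqAle lt_k.
have j0 : j = 0%N by move: Ek; nia.
by rewrite -Ek -ED2 -wlead_coef EP2 coefZ coefXn j0 (ltn_eqF d_gt0) mulr0.
Qed.

(** * Excluding corners, and the induction on the degree *)

Section NoRectangle.
Hypothesis noS1 : forall k n : nat, (n < k)%N -> (1 <= n)%N ->
  ~ exists f : {mpoly K[2]}, S1 k n f /\ Gamma' f.

Lemma no_rectangle f k n c : Gamma' f -> (0 < k)%N -> (0 < n)%N -> c != 0 ->
  wdeg 1 1 f = (k + n)%N -> wlead 1 1 f = c *: 'X^n -> False.
Proof.
move=> Gf k_gt0 n_gt0 nzc Edeg Elead.
have Gf' := Gamma'_endo (tame_swap K) Gf.
have coefkn : f@_(mon2 k n) = c.
  have := coef_wlead11 f n; rewrite Edeg leq_addl addnK Elead => <-.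
  by rewrite coefZ coefXn eqxx mulr1.
have wlead_swap : wlead 1 1 (endo y x f) = c *: 'X^k.
  apply/polyP => j; rewrite coef_wlead11 wdeg11_swap Edeg coef_swap coefZ coefXn.
  case: ifP => [le_j|gt_j]; last first.
    have /negPf -> : j != k by lia.
    by rewrite mulr0.
  have := coef_wlead11 f (k + n - j); rewrite Edeg leq_subr subKn // => <-.
  rewrite Elead coefZ coefXn; congr (_ * _%:R); congr (nat_of_bool _); lia.
have Sf : S1 k n f.
  split; first by rewrite coefkn.
  move=> i j /orP[lt_ki|lt_nj]; last exact: (no_edge Gf k_gt0 n_gt0 nzc Edeg Elead).
  rewrite -coef_swap; apply: (no_edge Gf' n_gt0 k_gt0 nzc _ wlead_swap) => //.
  by rewrite wdeg11_swap Edeg addnC.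
have Sf' : S1 n k (endo y x f).
  split; first by rewrite coef_swap coefkn.
  by move=> i j; rewrite orbC coef_swap; apply: Sf.2.
have [lt_nk|lt_kn|Ekn] := ltngtP n k.
- by apply: (noS1 lt_nk n_gt0); exists f.
- by apply: (noS1 lt_kn k_gt0); exists (endo y x f).
(* For k = n the root 0 of c Y^n has multiplicity n, and 2 n is the degree, against [wlead_mup]. *)
have p_gt0 : (0 < wdeg 1 1 f)%N by rewrite Edeg addn_gt0 k_gt0.
have := @wlead_mup K charK0 1 1 f (ltnSn 0) p_gt0 Gf 0.
rewrite Elead rootZ // rootE hornerXn expf_eq0 n_gt0 eqxx => /(_ isT).
rewrite -mul_polyC mupMr ?rootC // -['X^n](congr1 (fun P => P ^+ n) (subr0 'X)) mup_XsubCX eqxx Edeg.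
by move=> /negP; apply; lia.
Qed.

(** The leading form has degree d < p in Y, so two distinct roots would give 2 p <= 2 d. A linear
    shear moves the single root to 0, which leaves the vertex (p - d, d): the pure case if d = 0, a
    corner excluded by [no_rectangle] otherwise. *)
Lemma completes_small f : Gamma' f -> (wlead 1 1 f)`_(wdeg 1 1 f) = 0 ->
  (forall h, Gamma' h -> (wdeg 1 1 h < wdeg 1 1 f)%N -> completes h) -> completes f.
Proof.
move=> Gf Etop IH; have p_gt0 := Gamma'_wdeg11 Gf.
set p := wdeg 1 1 f in Etop p_gt0 IH; set P := wlead 1 1 f in Etop.
have nzP : P != 0.
  rewrite wlead_eq0 //; apply: contraTneq p_gt0 => f0; by rewrite /p f0 /wdeg rmorph0 size_poly0.
have nzl : lead_coef P != 0 by rewrite lead_coef_eq0.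
set d := (size P).-1.
have lt_dp : (d < p)%N.
  rewrite ltn_neqAle; apply/andP; split.
    by apply: contra nzl => /eqP E; rewrite lead_coefE -/d E Etop.
  rewrite leqNgt; apply: contra nzl => lt_pd.
  by rewrite lead_coefE -/d coef_wlead11 leqNgt lt_pd.
have [z EP] : exists z, P = lead_coef P *: ('X - z%:P) ^+ d.
  apply: single_root => // cs us rs.
  case: (wlead_roots charK0 (ltnSn 0) p_gt0 Gf us rs) => //; rewrite -/P -/d -/p => le_cs.
  rewrite leqNgt; apply/negP => gt1.
  have le2 : (2 * p <= size cs * p)%N by rewrite leq_mul2r gt1 orbT.
  by have := leq_trans le2 le_cs; rewrite leq_pmul2l // leqNgt lt_dp.
have ts := tame_shear 1 z; have [] := wlead_shift 1 z f; set f1 := endo _ _ f.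
rewrite -/P -/p => ED1 EP1.
have {EP1} EP1 : wlead 1 1 f1 = lead_coef P *: 'X^d by rewrite EP1 {1}EP comp_polyZ XsubC_exp_shift.
have Gf1 : Gamma' f1 by exact: Gamma'_endo ts Gf.
apply: (completes_endo ts); rewrite -/f1.
case: (posnP d) => [d0|d_gt0].
  apply: (completes_pure Gf1 p_gt0 nzl ED1 _ IH).
  by rewrite EP1 d0 expr0 alg_polyC.
have pd_gt0 : (0 < p - d)%N by rewrite subn_gt0.
have ED : wdeg 1 1 f1 = (p - d + d)%N by rewrite subnK // ltnW.
by case: (no_rectangle Gf1 pd_gt0 d_gt0 nzl ED EP1).
Qed.

Lemma Gamma'_completes f : Gamma' f -> completes f.
Proof.
move: (leqnn (wdeg 1 1 f)); move: {2}(wdeg 1 1 f) => N.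
elim: N f => [|N IHN] f le_N Gf.
  by have := leq_trans (Gamma'_wdeg11 Gf) le_N.
have IH h : Gamma' h -> (wdeg 1 1 h < wdeg 1 1 f)%N -> completes h.
  by move=> Gh lt_h; apply: IHN => //; rewrite -ltnS (leq_trans lt_h).
set P := wlead 1 1 f; have p_gt0 := Gamma'_wdeg11 Gf.
have [sP|/closed_rootP[z rz]] := eqVneq (size P) 1%N.
  by apply: completes_small IH => //; rewrite nth_default // -/P sP.
(* Moving the root z to 0 removes the pure power of X from the leading form, and the swap turns this
   into the vanishing coefficient that [completes_small] asks for. *)
have ts := tame_shear 1 z; have [] := wlead_shift 1 z f; set f1 := endo _ _ f.
rewrite -/P => ED1 EP1.
apply: (completes_endo ts); rewrite -/f1; apply: (completes_endo (tame_swap K)).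
have Gf1 : Gamma' f1 by exact: Gamma'_endo ts Gf.
have ED2 : wdeg 1 1 (endo y x f1) = wdeg 1 1 f := etrans (wdeg11_swap f1) ED1.
have Gf2 : Gamma' (endo y x f1) := Gamma'_endo (tame_swap K) Gf1.
apply: (completes_small Gf2); rewrite ED2; last exact: IH.
rewrite coef_wlead11 ED2 leqnn subnn coef_swap.
have := coef_wlead11 f1 0; rewrite ED1 leq0n subn0 EP1 => <-.
by rewrite -horner_coef0 horner_comp !hornerE (eqP rz).
Qed.

End NoRectangle.
End Backward.

Theorem proposition3p12 (K : closedFieldType)
    (charK0 : [pchar K]%R =i pred0) :
  JC2 K <->
  (forall k n : nat, (n < k)%N -> (1 <= n)%N ->
     ~ exists f : {mpoly K[2]}, S1 k n f /\ Gamma' f).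
Proof.
split=> [JC k n lt_nk n_gt0 [f [Sf Gf]]|noS1 f g [c nzc Efg]].
  exact: (JC2_S1_Gamma' charK0 JC lt_nk n_gt0 Sf Gf).
exact: (Gamma'_completes charK0 noS1 (Gamma'P nzc Efg) nzc Efg).
Qed.
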